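(* Let $\mathbb{F}\in\{\mathbb{R},\mathbb{C}\}$, $d\ge2$, $n\ge 1$, let $a_{k,j}\in\mathbb{F}$ ($2\le k\le n$, $2\le j\le d$), and let $L_0,\dots,L_n$ be defined by $L_0=1$, $L_1=x_1$ and, for $2\le k\le n$, $$L_k=\Psi_1(M_1)+\sum_{j=2}^d\Psi_j\big((M_j)_{i_1=\dots=i_{j-1}=0}\big)+a_{k,2}x_2+\dots+a_{k,d}x_d,\quad M_1=L_{k-1},\ M_j=\sum_{t=2}^{k-1}a_{t,j}L_{k-t}.$$ Let $\mathbf{z}_0\in\mathbb{F}^d$ and for $i=0,\dots,n$ define $$\mathbf{z}_i(h)=\mathbf{z}_0+\Big(ih,\ \sum_{j=2}^n a_{j,2}(ih)^j,\ \dots,\ \sum_{j=2}^n a_{j,d}(ih)^j\Big).$$ For $m\ge0$ and $0\le k\le m$ let $A^{(m)}_k=(-1)^{m-k}\frac{1}{k!(m-k)!}$. Then for every function $f$ analytic at $\mathbf{z}_0$ and every $m=0,\dots,n$, $$(L_m(D)f)(\mathbf{z}_0)=\lim_{h\to0}\frac{1}{h^m}\sum_{r=0}^mA^{(m)}_r f(\mathbf{z}_r(h)).$$ In other words, $\mathrm{span}\{\delta_{\mathbf{z}_0}\circ L_0(D),\dots,\delta_{\mathbf{z}_0}\circ L_n(D)\}=\lim_{h\to0}\mathrm{span}\{\delta_{\mathbf{z}_i(h)}:i=0,\dots,n\}$.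
   Context: $\Psi_j$ is the linear operator on polynomials with $\Psi_j(x_1^{\alpha_1}\cdots x_d^{\alpha_d})=\frac{1}{\alpha_j+1}x_1^{\alpha_1}\cdots x_j^{\alpha_j+1}\cdots x_d^{\alpha_d}$; $(M)_{i_1=\dots=i_{j-1}=0}$ is the sum of the terms of $M$ containing none of $x_1,\dots,x_{j-1}$. For $p=\sum_\alpha c_\alpha\mathbf{x}^\alpha$, $p(D)=\sum_\alpha c_\alpha\,\partial^{|\alpha|}/\partial x_1^{\alpha_1}\cdots\partial x_d^{\alpha_d}$. $\delta_{\mathbf z}$ denotes evaluation at $\mathbf z$; the limit of spans is understood in the sense of the preceding pointwise limit formula. *)

(* Defs.v *)
From HB Require Import structures.
From mathcomp Require Import all_boot all_order all_algebra.
From mathcomp Require Import mpoly.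
From mathcomp Require Import all_classical all_reals all_analysis.
From mathcomp Require Import complex.

Set Implicit Arguments. Unset Strict Implicit. Unset Printing Implicit Defensive.
Import Order.TTheory GRing.Theory Num.Theory.
Import numFieldNormedType.Exports.
Local Open Scope ring_scope.
Local Open Scope classical_set_scope.

Section Defs.
Variable K : numFieldType.
Variable d : nat.

Local Notation poly := (mpoly.mpoly d K).
Local Notation mnm := (mpoly.multinom d).

Definition mexp (m : mnm) (i : 'I_d) : nat := mpoly.fun_of_multinom m i.

(* The variable x_{i+1} (0-based nat index i), as a polynomial. *)
Definition Xvar (i : nat) : poly :=
  match (insub i : option 'I_d) with
  | Some i' => mpoly.mpolyX K (mpoly.mnm1 i')
  | None => 0
  end.

(* Psi_{i+1} (0-based nat index i): the linear operator with
   Psi(x^alpha) = x^(alpha + e_i) / (alpha_i + 1). *)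
Definition Psi (i : nat) (p : poly) : poly :=
  match (insub i : option 'I_d) with
  | Some i' =>
      \sum_(m <- mpoly.msupp p)
         (mpoly.mcoeff m p / (mexp m i').+1%:R)
            *: mpoly.mpolyX K (mpoly.mnm_add m (mpoly.mnm1 i'))
  | None => 0
  end.

(* restr k p = the sum of the terms of p containing none of the
   (0-based) variables 0, ..., k-1, i.e. none of x_1, ..., x_k.
   (M)_{i_1 = ... = i_{j-1} = 0} is  restr (j-1) M. *)
Definition restr (k : nat) (p : poly) : poly :=
  \sum_(m <- mpoly.msupp p | [forall i : 'I_d, (i < k)%N ==> (mexp m i == 0%N)])
     mpoly.mcoeff m p *: mpoly.mpolyX K m.

(* The coefficients a_{k,j} (1-based indices as in the paper; only the
   values with 2 <= k <= n, 2 <= j <= d are ever used). *)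
Variable a : nat -> nat -> K.

(* L_k from the list s = [:: L_0; ...; L_{k-1}], for k >= 2:
   L_k = Psi_1(L_{k-1})
         + sum_{j=2}^d Psi_j((sum_{t=2}^{k-1} a_{t,j} L_{k-t})_{i_1=..=i_{j-1}=0})
         + a_{k,2} x_2 + ... + a_{k,d} x_d. *)
Definition Lnext (k : nat) (s : seq poly) : poly :=
  Psi 0 (nth 0 s k.-1)
  + \sum_(2 <= j < d.+1)
       Psi j.-1 (restr j.-1 (\sum_(2 <= t < k) a t j *: nth 0 s (k - t)))
  + \sum_(2 <= j < d.+1) a k j *: Xvar j.-1.

Fixpoint Ls (k : nat) : seq poly :=
  match k with
  | 0 => [:: 1]
  | 1 => [:: 1; Xvar 0]
  | k'.+1 => let s := Ls k' in rcons s (Lnext k s)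
  end.

Definition L (k : nat) : poly := nth 0 (Ls k) k.

Definition unitv (i : 'I_d) : 'rV[K]_d := delta_mx 0 i.

Definition pderiv (i : 'I_d) (g : 'rV[K]_d -> K^o) : 'rV[K]_d -> K^o :=
  fun x => 'D_(unitv i) g x.

Definition Dmnm (m : mnm) (g : 'rV[K]_d -> K^o) : 'rV[K]_d -> K^o :=
  foldr (fun i h => iter (mexp m i) (pderiv i) h) g (enum 'I_d).

Definition polyD (p : poly) (g : 'rV[K]_d -> K^o) (z : 'rV[K]_d) : K :=
  \sum_(m <- mpoly.msupp p) mpoly.mcoeff m p * Dmnm m g z.

(* Analyticity at z0: f is given, on a polydisc around z0, by an absolutely
   convergent power series sum_alpha c_alpha (z - z0)^alpha. *)
Definition pterm (c : ('I_d -> nat) -> K) (z0 z : 'rV[K]_d)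
    (al : 'I_d -> nat) : K :=
  c al * \prod_(i < d) (z 0 i - z0 0 i) ^+ al i.

Definition boxsum (N : nat) (F : ('I_d -> nat) -> K) : K :=
  \sum_(al : {ffun 'I_d -> 'I_N}) F (fun i => nat_of_ord (al i)).

Definition analytic_at (f : 'rV[K]_d -> K^o) (z0 : 'rV[K]_d) : Prop :=
  exists (c : ('I_d -> nat) -> K) (r : K), 0 < r /\
    forall z : 'rV[K]_d, (forall i : 'I_d, `|z 0 i - z0 0 i| < r) ->
      (exists M : K, forall N : nat, boxsum N (fun al => `|pterm c z0 z al|) <= M)
      /\ (fun N => boxsum N (pterm c z0 z)) @ \oo --> (f z : K).

Definition zpt (n : nat) (z0 : 'rV[K]_d) (i : nat) (h : K) : 'rV[K]_d :=
  z0 + \row_(c < d) (if (c : nat) == 0%N then i%:R * h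
                     else \sum_(2 <= j < n.+1) a j c.+1 * (i%:R * h) ^+ j).

End Defs.

Definition Acoef (K : numFieldType) (m k : nat) : K :=
  (-1) ^+ (m - k) / ((k`!)%:R * ((m - k)`!)%:R).

Definition theorem9_for (K : numFieldType) : Prop :=
  forall (d n : nat), (2 <= d)%N -> (1 <= n)%N ->
  forall (a : nat -> nat -> K) (z0 : 'rV[K]_d) (f : 'rV[K]_d -> K^o),
  analytic_at f z0 ->
  forall m : nat, (m <= n)%N ->
    (fun h : K => h ^- m * \sum_(r < m.+1) Acoef K m r * f (@zpt K d a n z0 r h))
      @ (0 : K)^' --> polyD (@L K d a m) f z0.

(* Main.v *)
(* Let gamma(t) = (t, sum_j a_(j,2) t^j, ..., sum_j a_(j,d) t^j), so that
   z_r(h) = z_0 + gamma(r h). Writing exp <x, gamma(t)> as the product of the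
   exp (gamma_i(t) x_i) and removing the factors one at a time shows that the
   recursion defining L_k computes the coefficient of t^k in exp <x, gamma(t)>.
   Hence, if f has Taylor coefficients c_alpha at z_0, L_m(D) f (z_0) is the
   coefficient of t^m in sum_alpha c_alpha gamma(t)^alpha = f(z_0 + gamma(t)),
   and the weights A^(m)_r, being those of the m-th finite difference over m!,
   extract this coefficient. Term-by-term differentiation of the power series
   rests on comparing the derivatives and the difference quotients of w^p with
   single terms of the binomial expansion of (|w| + s)^p. *)

Require Import Defs.
From HB Require Import structures.
From mathcomp Require Import all_boot all_order all_algebra.
From mathcomp Require Import mpoly.
From mathcomp Require Import all_classical all_reals all_analysis.
From mathcomp Require Import complex.
From mathcomp Require Import ring lra zify.

Set Implicit Arguments. Unset Strict Implicit. Unset Printing Implicit Defensive.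
Import Order.TTheory GRing.Theory Num.Theory.
Import numFieldNormedType.Exports.
Local Open Scope ring_scope.
Local Open Scope classical_set_scope.

(** * Moments of the finite-difference weights *)

Section FiniteDifferences.
Variable K : numFieldType.

Lemma AcoefS (m r : nat) : r.+1%:R * Acoef K m.+1 r.+1 = Acoef K m r.
Proof.
rewrite /Acoef subSS factS !natrM.
have h1 : (r.+1%:R : K) != 0 by rewrite pnatr_eq0.
have h2 : (r`!%:R : K) != 0 by rewrite pnatr_eq0 -lt0n fact_gt0.
have h3 : ((m - r)`!%:R : K) != 0 by rewrite pnatr_eq0 -lt0n fact_gt0.
by field; rewrite nat1r h1 h2 h3.
Qed.

(** Multiplied by m!, the sum is the binomial expansion of (-1 + 1)^m. *)
Lemma sum_Acoef (m : nat) : \sum_(r < m.+1) Acoef K m r = (m == 0%N)%:R.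
Proof.
have hm : (m`!%:R : K) != 0 by rewrite pnatr_eq0 -lt0n fact_gt0.
apply: (mulfI hm).
transitivity ((-1 + 1 : K) ^+ m); last first.
  by case: m {hm} => [|m]; rewrite addNr ?expr0n /= ?mulr1 ?mulr0 ?fact0.
rewrite exprDn mulr_sumr; apply: eq_bigr => r _.
have hr : (r <= m)%N by rewrite -ltnS.
rewrite -(bin_fact hr) !natrM /Acoef expr1n mulr1 -mulr_natr.
have h2 : (r`!%:R : K) != 0 by rewrite pnatr_eq0 -lt0n fact_gt0.
have h3 : ((m - r)`!%:R : K) != 0 by rewrite pnatr_eq0 -lt0n fact_gt0.
by field; rewrite h2 h3.
Qed.

(** The base point [x] is there for the induction on [j]: in (x + r)^(j+1) = x (x + r)^j + r (x +
    r)^j the first part sums to 0 because j < m, and [AcoefS] turns the second into the same sum for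
    [m] and [j] lowered by one, based at x + 1. *)
Lemma sum_Acoef_exp (m j : nat) (x : K) : (j <= m)%N ->
  \sum_(r < m.+1) Acoef K m r * (x + r%:R) ^+ j = (j == m)%:R.
Proof.
elim: j m x => [|j IH] m x hj.
  under eq_bigr do rewrite expr0 mulr1.
  by rewrite sum_Acoef eq_sym.
case: m hj => // m hj.
under eq_bigr do rewrite exprS mulrCA mulrDl.
rewrite big_split /= -mulr_sumr IH; last exact: leqW.
rewrite ltn_eqF // mulr0 add0r big_ord_recl /= mul0r add0r eqSS -(IH m (x + 1)) //.
apply: eq_bigr => r _; rewrite /bump /= add1n mulrA.
by rewrite AcoefS -addrA nat1r.
Qed.

End FiniteDifferences.

(** * The polynomials L_k as coefficients of exp <x, gamma(t)> *)

Section Coefficients.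
Variables (K : numFieldType) (d n : nat) (a : nat -> nat -> K).
Local Notation mnm := (mpoly.multinom d).

(** Coordinates are counted from 0, the second index of [a] from 1; hence [c.+1]. *)
Definition curve (c : nat) : {poly K} :=
  if c == 0%N then 'X else \sum_(2 <= j < n.+1) a j c.+1 *: 'X^j.

Definition curve_mon (al : 'I_d -> nat) : {poly K} := \prod_(i < d) curve i ^+ al i.

Definition mfact (al : 'I_d -> nat) : nat := (\prod_(i < d) (al i)`!)%N.

Lemma mfact_neq0 al : (mfact al)%:R != 0 :> K.
Proof. by rewrite pnatr_eq0 -lt0n prodn_gt0 // => i; exact: fact_gt0. Qed.

(** Adding e_i to an exponent is injective, so at most one monomial of [p] lands on x^m, namely the
    one with exponent m - e_i. *)
Lemma mcoeff_Psi (i : 'I_d) (p : {mpoly K[d]}) (m : mnm) :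
  (Psi i p)@_m = if mexp m i is q.+1
                 then p@_(mpoly.mnm_sub m (mpoly.mnm1 i)) / q.+1%:R else 0.
Proof.
rewrite /Psi insubT /= => [//|lt_id].
have -> : Sub (i : nat) lt_id = i by apply: val_inj.
rewrite raddf_sum /=.
under eq_bigr do rewrite mpoly.mcoeffZ mpoly.mcoeffX.
case E : (mexp m i) => [|q].
  apply: big1 => m' _; case: eqP => [Em|_]; last by rewrite mulr0.
  by move: E; rewrite /mexp -Em mpoly.mnmDE mpoly.mnm1E eqxx addn1.
have hle : mpoly.mnm_add (mpoly.mnm_sub m (mpoly.mnm1 i)) (mpoly.mnm1 i) = m.
  apply/mpoly.mnmP => j; rewrite mpoly.mnmDE mpoly.mnmBE mpoly.mnm1E.
  by case: eqP => [<-|_]; rewrite ?subn0 ?addn0 // -/(mexp m i) E subn1 addn1.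
have hinj m' : mpoly.mnm_add m' (mpoly.mnm1 i) = m ->
    m' = mpoly.mnm_sub m (mpoly.mnm1 i).
  by move=> <-; apply/mpoly.mnmP => j; rewrite mpoly.mnmBE mpoly.mnmDE addnK.
case: (boolP (mpoly.mnm_sub m (mpoly.mnm1 i) \in mpoly.msupp p)) => hs.
  rewrite (bigD1_seq _ hs) ?mpoly.msupp_uniq //= hle eqxx mulr1 big1 ?addr0.
    by rewrite /mexp mpoly.mnmBE mpoly.mnm1E eqxx -/(mexp m i) E subn1.
  move=> m' hm'; case: eqP => [/hinj em|_]; last by rewrite mulr0.
  by rewrite em eqxx in hm'.
have /eqP -> : p@_(mpoly.mnm_sub m (mpoly.mnm1 i)) == 0.
  by rewrite mpoly.mcoeff_eq0.
rewrite mul0r big1_seq // => m' /andP[_ hm'].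
case: eqP => [/hinj em|_]; last by rewrite mulr0.
by rewrite -em hm' in hs.
Qed.

Lemma mcoeff_restr k (p : {mpoly K[d]}) (m : mnm) :
  (restr k p)@_m =
  if [forall i : 'I_d, (i < k)%N ==> (mexp m i == 0%N)] then p@_m else 0.
Proof.
rewrite /restr raddf_sum /=.
under eq_bigr do rewrite mpoly.mcoeffZ mpoly.mcoeffX.
case: (boolP (m \in mpoly.msupp p)) => hs; last first.
  have /eqP -> : p@_m == 0 by rewrite mpoly.mcoeff_eq0.
  rewrite if_same big_seq_cond big1 // => m' /andP[hm' _].
  by case: eqP => [em|_]; [rewrite -em hm' in hs | rewrite mulr0].
rewrite big_mkcond /= (bigD1_seq _ hs) ?mpoly.msupp_uniq //= eqxx mulr1.
rewrite big1 ?addr0 // => m' /negPf ->.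
by rewrite mulr0 if_same.
Qed.

Lemma mcoeff_Xvar (i : 'I_d) (m : mnm) :
  (Xvar K d i)@_m = (m == mpoly.mnm1 i)%:R.
Proof.
rewrite /Xvar insubT /= => [//|lt_id].
have -> : Sub (i : nat) lt_id = i by apply: val_inj.
by rewrite mpoly.mcoeffX eq_sym.
Qed.

Lemma size_Ls k : size (Ls d a k) = k.+1.
Proof. by elim: k => [|[|k] IH] //=; rewrite size_rcons /= IH. Qed.

Lemma nth_Ls k i : (i <= k)%N -> nth 0 (Ls d a k) i = L d a i.
Proof.
elim: k => [|k IH]; first by case: i.
rewrite leq_eqVlt ltnS => /predU1P[-> //|hi].
rewrite -(IH hi); case: k {IH} hi => [|k] hi; first by case: i hi.
have -> : Ls d a k.+2 = rcons (Ls d a k.+1) (Lnext a k.+2 (Ls d a k.+1)) by [].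
by rewrite nth_rcons size_Ls ltnS hi.
Qed.

Lemma L_rec k : (2 <= k)%N ->
  L d a k = Psi 0 (L d a k.-1)
  + \sum_(2 <= j < d.+1)
       Psi j.-1 (restr j.-1 (\sum_(2 <= t < k) a t j *: L d a (k - t)))
  + \sum_(2 <= j < d.+1) a k j *: Xvar K d j.-1.
Proof.
case: k => [|[|k]] // _; rewrite {1}/L.
have -> : Ls d a k.+2 = rcons (Ls d a k.+1) (Lnext a k.+2 (Ls d a k.+1)) by [].
rewrite nth_rcons size_Ls ltnn eqxx /Lnext nth_Ls //.
congr (_ + _ + _); apply: eq_bigr => j _; congr (Psi _ (restr _ _)).
apply: eq_big_nat => t ht; rewrite nth_Ls //; lia.
Qed.

Lemma coef_curve c j :
  (curve c)`_j = if c == 0%N then (j == 1%N)%:R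
                 else if (2 <= j <= n)%N then a j c.+1 else 0.
Proof.
rewrite /curve; case: eqP => _; first by rewrite coefX.
rewrite coef_sum; under eq_bigr do rewrite coefZ coefXn.
case: ifP => hj.
  rewrite (bigD1_seq j) ?iota_uniq ?mem_index_iota //= eqxx mulr1.
  by rewrite big1 ?addr0 // => i /negPf hi; rewrite eq_sym hi mulr0.
rewrite big1_seq // => i /andP[_]; rewrite mem_index_iota => hi.
by case: eqP => [e|_]; rewrite ?mulr0 //; move: hi; rewrite -e ltnS hj.
Qed.

(* Since curve c vanishes at 0, X^|al| divides curve_mon al. *)
Lemma coef_curve_mon_lt al k : (k < \sum_(i < d) al i)%N -> (curve_mon al)`_k = 0.
Proof.
pose q (c : nat) := if c == 0%N then 1 else
  (\sum_(2 <= j < n.+1) a j c.+1 *: 'X^(j.-1))%R : {poly K}.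
have qE c : curve c = q c * 'X.
  rewrite /curve /q; case: eqP => _; first by rewrite mul1r.
  rewrite mulr_suml; apply: eq_big_nat => j hj.
  by rewrite -scalerAl -exprSr prednK //; lia.
have -> : curve_mon al = (\prod_(i < d) q i ^+ al i) * 'X^(\sum_(i < d) al i).
  rewrite -prodrXr -big_split /=; apply: eq_bigr => i _.
  by rewrite qE exprMn.
by move=> hk; rewrite coefMXn hk.
Qed.

Lemma curve_mon_mulS al (i : 'I_d) :
  curve_mon (fun j => (al j + (i == j))%N) = curve i * curve_mon al.
Proof.
rewrite /curve_mon (bigD1 i) //= [in RHS](bigD1 i) //= eqxx addn1 exprS -mulrA.
congr (_ * (_ * _)); apply: eq_bigr => j hj.
by rewrite eq_sym (negPf hj) addn0.
Qed.

Lemma mfactS al (i : 'I_d) :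
  mfact (fun j => (al j + (i == j))%N) = ((al i).+1 * mfact al)%N.
Proof.
rewrite /mfact (bigD1 i) //= [in RHS](bigD1 i) //= eqxx addn1 factS -mulnA.
congr (_ * (_ * _))%N; apply: eq_bigr => j hj.
by rewrite eq_sym (negPf hj) addn0.
Qed.

Hypothesis d_ge2 : (2 <= d)%N.

(* L_k is the coefficient of t^k in exp <x, gamma(t)>, where curve i = gamma_i. *)
Lemma mcoeff_L k (m : mnm) : (k <= n)%N ->
  (L d a k)@_m = (curve_mon (mexp m))`_k / (mfact (mexp m))%:R.
Proof.
move=> hk; elim/ltn_ind: k m hk => k IH m hk.
have [|k_gt0] := posnP k; first move=> ->.
  rewrite /L /= mpoly.mcoeff1; case: eqP => [->|nz].
    rewrite /curve_mon /mfact !big1 ?coef1 ?eqxx ?divr1 // => i _;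
    by rewrite /mexp mpoly.mnm0E.
  rewrite coef_curve_mon_lt ?mul0r // lt0n sum_nat_eq0; apply/negP => /forallP z.
  by apply: nz; apply/mpoly.mnmP => i; rewrite mpoly.mnm0E; apply/eqP/z.
have Xvar0 : Xvar K d 0 = Xvar K d (Ordinal (ltnW d_ge2)) by [].
have Psi0 (p : {mpoly K[d]}) : Psi 0 p = Psi (Ordinal (ltnW d_ge2)) p by [].
(* For m = 0 both sides vanish: every term of the recursion carries a variable. *)
have [/forallP m0|] := boolP [forall i, mexp m i == 0%N].
  have -> : curve_mon (mexp m) = 1.
    by rewrite /curve_mon big1 // => i _; rewrite (eqP (m0 i)) expr0.
  rewrite coef1 gtn_eqF // mul0r.
  have PsiE (i : 'I_d) (p : {mpoly K[d]}) : (Psi i p)@_m = 0.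
    by rewrite mcoeff_Psi (eqP (m0 i)).
  have XvarE (i : 'I_d) : (Xvar K d i)@_m = 0.
    rewrite mcoeff_Xvar; case: eqP => // e.
    by have := m0 i; rewrite e /mexp mpoly.mnm1E eqxx.
  case: k {IH} hk k_gt0 => [|[|k]] // hk _; first by rewrite /L /= Xvar0 XvarE.
  rewrite L_rec // !mpoly.mcoeffD Psi0 PsiE add0r !raddf_sum /= !big1_seq ?addr0 //.
    move=> j /andP[_]; rewrite mem_index_iota mpoly.mcoeffZ => hj.
    have lt_jd : (j.-1 < d)%N by lia.
    by rewrite -[j.-1]/(Ordinal lt_jd : nat) XvarE mulr0.
  move=> j /andP[_]; rewrite mem_index_iota => hj.
  have lt_jd : (j.-1 < d)%N by lia.
  by rewrite -[X in Psi X]/(Ordinal lt_jd : nat) PsiE.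
rewrite negb_forall => /existsP[i0 hi0].
(* Let [i] be the least variable of x^m. Because of the restrictions, each Psi-term of the recursion
   only has monomials whose least variable is the one it multiplies by, so a single Psi-term can
   contribute to x^m. *)
case: (@arg_minnP _ i0 (fun i => mexp m i != 0%N) val hi0) => i hi imin {i0 hi0}.
pose b := mpoly.mnm_sub m (mpoly.mnm1 i).
have mE : mexp m = fun j => (mexp b j + (i == j))%N.
  apply/funext => j; rewrite /mexp mpoly.mnmBE mpoly.mnm1E.
  case: eqP => [<-|_]; last by rewrite subn0 addn0.
  by rewrite subnK // lt0n.
have mi : mexp m i = (mexp b i).+1 by rewrite mE eqxx addn1.
have mlt (j : 'I_d) : (j < i)%N -> mexp m j = 0%N.
  by move=> ltji; apply/eqP/negPn/negP => /imin /=; rewrite leqNgt ltji.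
have meq (j : 'I_d) : (m == mpoly.mnm1 j) = (j == i) && (b == mpoly.mnm0).
  apply/eqP/andP => [em|[/eqP -> /eqP b0]].
    have ji : j = i.
      by apply/eqP; move: hi; rewrite em /mexp mpoly.mnm1E; case: (j == i).
    split; first by rewrite ji.
    by apply/eqP/mpoly.mnmP => l; rewrite mpoly.mnmBE em ji subnn mpoly.mnm0E.
  apply/mpoly.mnmP => l; rewrite -/(mexp m l) mE b0 /mexp mpoly.mnm0E.
  by rewrite mpoly.mnm1E.
have b0 : (curve_mon (mexp b))`_0 = (b == mpoly.mnm0)%:R.
  case: eqP => [->|nz].
    by rewrite /curve_mon big1 ?coef1 // => l _; rewrite /mexp mpoly.mnm0E.
  rewrite coef_curve_mon_lt // lt0n sum_nat_eq0; apply/negP => /forallP z.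
  by apply: nz; apply/mpoly.mnmP => l; rewrite mpoly.mnm0E; apply/eqP/z.
have restr0 (j : 'I_d) (p : {mpoly K[d]}) : (i < j)%N -> (Psi j (restr j p))@_m = 0.
  move=> ltij; rewrite mcoeff_Psi; case: (mexp m j) => // q.
  rewrite mcoeff_restr; case: forallP => [/(_ i)|]; last by rewrite mul0r.
  rewrite ltij /mexp mpoly.mnmBE mpoly.mnm1E -val_eqE /= (gtn_eqF ltij).
  by rewrite subn0 -/(mexp m i) mi.
(* Taking one factor [curve i] out of the product turns the claim into a Cauchy product, which the
   recursion has to reproduce term by term. *)
have -> : (curve_mon (mexp m))`_k / (mfact (mexp m))%:R =
    (\sum_(0 <= t < k.+1) (curve i)`_t * (curve_mon (mexp b))`_(k - t))
      / (mfact (mexp b))%:R / (mexp b i).+1%:R.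
  rewrite mE curve_mon_mulS mfactS coefM big_mkord -mulrA -invfM.
  by rewrite -natrM mulnC.
(* [L_rec] starts at 2, so L_1 is compared directly. *)
case: k hk k_gt0 IH => [|[|k]] // hk _ IH.
  rewrite big_nat_recl // big_nat1 !coef_curve subn0 subnn b0 /=.
  rewrite /L /= Xvar0 mcoeff_Xvar meq.
  rewrite if_same mul0r add0r -val_eqE /= eq_sym.
  case: eqP => [i0|]; last by rewrite !mul0r.
  case: (boolP (b == _)) => [/eqP b00|_]; last by rewrite mulr0 !mul0r.
  have -> : mfact (mexp b) = 1%N.
    by rewrite /mfact big1 // => l _; rewrite b00 /mexp mpoly.mnm0E.
  by rewrite b00 /mexp mpoly.mnm0E !divr1 mulr1.
rewrite L_rec // !mpoly.mcoeffD !raddf_sum /= Psi0.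
(* For the first variable [curve i] is t itself: only the index 1 of the Cauchy product survives,
   and it matches Psi_1(L_{k-1}). *)
have [i0|i_neq0] := eqVneq (i : nat) 0%N.
  have -> : Ordinal (ltnW d_ge2) = i by apply: val_inj; rewrite /= i0.
  rewrite mcoeff_Psi mi -/b IH; [|lia|lia].
  rewrite [X in _ + X + _]big1_seq ?[X in _ + _ + X]big1_seq ?addr0.
  - rewrite (bigD1_seq 1%N) ?iota_uniq ?mem_index_iota //= coef_curve i0 /=.
    rewrite mul1r subn1 big1 ?addr0 // => t /negPf ht.
    by rewrite coef_curve /= ht mul0r.
  - move=> j /andP[_]; rewrite mem_index_iota => hj.
    have lt_jd : (j.-1 < d)%N by lia.
    rewrite mpoly.mcoeffZ -[j.-1]/(Ordinal lt_jd : nat) mcoeff_Xvar meq.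
    by rewrite -val_eqE /= i0; case: eqP; rewrite ?mulr0 //; lia.
  - move=> j /andP[_]; rewrite mem_index_iota => hj.
    have lt_jd : (j.-1 < d)%N by lia.
    by rewrite -[j.-1]/(Ordinal lt_jd : nat) restr0 //= i0; lia.
(* Only [j = i.+1] survives in the two sums: for smaller [j] the variable of index [j.-1] does not
   divide x^m, and for larger [j] the restriction excludes the variable [i]. *)
rewrite mcoeff_Psi mlt ?add0r /=; last by rewrite lt0n.
rewrite [X in X + _](bigD1_seq i.+1) ?[X in _ + X](bigD1_seq i.+1) ?iota_uniq //=;
  try by rewrite mem_index_iota ltnS lt0n i_neq0 ltnS ltn_ord.
rewrite [X in (_ + X) + _]big1_seq ?[X in _ + (_ + X)]big1_seq ?addr0.
- rewrite mpoly.mcoeffZ mcoeff_Xvar meq eqxx mcoeff_Psi mi -/b mcoeff_restr.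
  rewrite ifT; last first.
    apply/forallP => l; apply/implyP => /mlt; rewrite mE => /eqP.
    by rewrite addn_eq0 => /andP[].
  (* The linear term contributes only when b = 0, where both divisors are 1; inserting them gives
     all terms a common denominator. *)
  have -> : (b == 0%MM)%:R =
      (b == 0%MM)%:R / (mfact (mexp b))%:R / (mexp b i).+1%:R :> K.
    case: eqP => [e|_]; last by rewrite !mul0r.
    have -> : mfact (mexp b) = 1%N.
      by rewrite /mfact big1 // => l _; rewrite e /mexp mpoly.mnm0E.
    by rewrite e /mexp mpoly.mnm0E !divr1.
  rewrite !mulrA -!mulrDl; congr (_ / _).
  (* Here [curve i] starts at t^2, so the indices 0 and 1 drop out; the last index k pairs with the
     constant coefficient and yields the linear term with coefficient a_{k,j}. *)
  rewrite [in RHS]big_ltn // [in RHS]big_ltn // [in RHS]big_nat_recr //=.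
  rewrite !coef_curve (negPf i_neq0) /=.
  rewrite !mul0r !add0r hk subnn b0 mulrDl; congr (_ + _).
  rewrite raddf_sum /= mulr_suml; apply: eq_big_nat => t ht.
  rewrite mpoly.mcoeffZ IH; [|lia|lia].
  by rewrite coef_curve (negPf i_neq0) ifT ?mulrA //; lia.
- move=> j /andP[ji]; rewrite mem_index_iota => hj.
  have lt_jd : (j.-1 < d)%N by lia.
  rewrite mpoly.mcoeffZ -[j.-1]/(Ordinal lt_jd : nat) mcoeff_Xvar meq.
  by rewrite -val_eqE /=; case: eqP; rewrite ?mulr0 //; lia.
- move=> j /andP[ji]; rewrite mem_index_iota => hj.
  have lt_jd : (j.-1 < d)%N by lia.
  rewrite -[j.-1]/(Ordinal lt_jd : nat).
  have [lt_ji|] := ltnP (Ordinal lt_jd) i; first by rewrite mcoeff_Psi mlt.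
  rewrite leq_eqVlt => /predU1P[/= e|]; last exact: restr0.
  by move: ji; rewrite e; lia.
Qed.

End Coefficients.

(* The consequence of completeness used for multiple series: a sequence whose
   increments are dominated by those of a bounded sequence converges. *)
Definition dominated_complete (K : numFieldType) : Prop :=
  forall u v : nat -> K,
  (forall M N, (M <= N)%N -> `|u N - u M| <= v N - v M) ->
  (exists B, forall N, v N <= B) -> exists l : K, u @ \oo --> l.

(** Both v and u + v are nondecreasing and bounded above, hence convergent, and u is their
    difference. *)
Lemma dominated_complete_real (R : realType) : dominated_complete R.
Proof.
move=> u v huv [B hB].
have hv : {homo v : M N / (M <= N)%N >-> M <= N}.
  by move=> M N /huv h; rewrite -subr_ge0 (le_trans _ h).
have cv : cvgn v.
  by apply: nondecreasing_is_cvgn => //; exists B => _ [N _ <-].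
have cuv : cvgn (fun N => u N + v N).
  apply: nondecreasing_is_cvgn => [M N /huv|].
    by rewrite ler_norml => /andP[]; lra.
  exists (u 0%N - v 0%N + B + B) => _ [N _ <-].
  have := huv 0%N N (leq0n N); rewrite ler_norml => /andP[].
  by have := hB N; lra.
move: cv cuv => /cvg_ex[l hl] /cvg_ex[l' hl']; exists (l' - l).
have -> : u = (fun N => u N + v N) - v.
  by apply/funext => N; rewrite !fctE addrK.
exact: (cvgB hl' hl).
Qed.

(** The real case applies to the real and imaginary parts of u, both dominated by the real part of
    v. *)
Lemma dominated_complete_complex (R : realType) : dominated_complete R[i].
Proof.
move=> u v huv [B hB].
have ReP x y : x <= y :> R[i] -> complex.Re x <= complex.Re y.
  by rewrite lecE => /andP[].
have ReB (x y : R[i]) : complex.Re (x - y) = complex.Re x - complex.Re y.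
  by case: x => ? ?; case: y.
have ImB (x y : R[i]) : complex.Im (x - y) = complex.Im x - complex.Im y.
  by case: x => ? ?; case: y.
have bd : exists B : R, forall N, complex.Re (v N) <= B.
  by exists (complex.Re B) => N; exact: ReP.
have Re_le (x y : R[i]) : `|x| <= y -> `|complex.Re x| <= complex.Re y.
  by move=> xy; have := ReP _ _ (le_trans (normc_ge_Re x) xy).
have Im_le (x y : R[i]) : `|x| <= y -> `|complex.Im x| <= complex.Re y.
  move=> /ReP; apply: le_trans; rewrite normc_def /= -sqrtr_sqr ler_wsqrtr //.
  by rewrite lerDr sqr_ge0.
have norm_le (x : R[i]) : `|x| <= (`|complex.Re x| + `|complex.Im x|)%:C%C.
  rewrite normc_def lecR -[leRHS]ger0_norm ?addr_ge0 // -sqrtr_sqr ler_wsqrtr //.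
  rewrite sqrrD !real_normK ?num_real // addrAC lerDl mulrn_wge0 //.
have [|p hp] := @dominated_complete_real R (fun N => complex.Re (u N)) _ _ bd.
  by move=> M N hMN; rewrite -!ReB; apply/Re_le/huv.
have [|q hq] := @dominated_complete_real R (fun N => complex.Im (u N)) _ _ bd.
  by move=> M N hMN; rewrite -ReB -ImB; apply/Im_le/huv.
exists (p +i* q)%C; apply/cvgrPdist_le => e.
(* In the order of [R[i]] a positive e has zero imaginary part, so the estimate reduces to its real
   part. *)
rewrite ltcE => /andP[/eqP /= Ime e0].
have e2 : 0 < complex.Re e / 2 by rewrite divr_gt0.
move/cvgrPdist_le/(_ _ e2) : hp => [N1 _ h1].
move/cvgrPdist_le/(_ _ e2) : hq => [N2 _ h2].
exists (maxn N1 N2) => // N /=; rewrite geq_max => /andP[/h1 + /h2].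
move=> /= {}h1 {}h2; apply: le_trans (norm_le _) _; rewrite lecE /= Ime eqxx /=.
by rewrite ReB ImB /= [leRHS]splitr lerD.
Qed.

(** * Elementary estimates for limits, powers and polynomials *)

Section Estimates.
Variable K : numFieldType.

Lemma cvg_dist_linear (F : K -> K) (l C delta : K) : 0 <= C -> 0 < delta ->
  (forall h, h != 0 -> `|h| < delta -> `|F h - l| <= C * `|h|) ->
  F @ (0 : K)^' --> l.
Proof.
move=> C0 d0 hF; apply/cvgrPdist_le => e e0.
(* [C] may be 0, so the division below is by C + 1. *)
have C1 : 0 < C + 1 by rewrite ltr_wpDl.
near=> h.
have h0 : h != 0 by near: h; exact: nbhs_dnbhs_neq.
rewrite distrC; apply: le_trans (hF h h0 _) _; first by near: h; exact: dnbhs0_lt.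
have he : `|h| < e / (C + 1) by near: h; apply: dnbhs0_lt; exact: divr_gt0.
apply: (@le_trans _ _ ((C + 1) * `|h|)).
  by rewrite ler_wpM2r // lerDl.
by rewrite mulrC -ler_pdivlMr // ltW.
Unshelve. all: by end_near. Qed.

Lemma cvg_norm_le (u : nat -> K) (l B : K) (N0 : nat) : u @ \oo --> l ->
  (forall N, (N0 <= N)%N -> `|u N| <= B) -> `|l| <= B.
Proof.
move=> ul hB; apply/ler_addgt0Pr => e e0.
have /cvgrPdist_le/(_ e e0)[N1 _ hN] := ul.
have := hN (maxn N0 N1) (leq_maxr _ _).
move=> /= h; rewrite -[l](subrK (u (maxn N0 N1))) addrC.
by apply: le_trans (ler_normD _ _) _; rewrite lerD // hB // leq_maxl.
Qed.

(** After multiplication by s^k the left side is k! times the k-th term of the binomial expansion of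
    (rho + s)^n. *)
Lemma ffact_exp_le (rho s : K) (n k : nat) : 0 <= rho -> 0 < s ->
  (n ^_ k)%:R * rho ^+ (n - k) <= k`!%:R / s ^+ k * (rho + s) ^+ n.
Proof.
move=> rho0 s0; have s0' := ltW s0; have [lt_nk|le_kn] := ltnP n k.
  by rewrite ffact_small // mul0r !mulr_ge0 ?invr_ge0 ?exprn_ge0 ?addr_ge0.
rewrite mulrAC ler_pdivlMr ?exprn_gt0 // -bin_ffact natrM.
rewrite [_ * k`!%:R]mulrC -!mulrA ler_wpM2l // exprDn.
rewrite (bigD1 (Ordinal (le_kn : (k < n.+1)%N))) //= mulr_natl.
by rewrite lerDl sumr_ge0 // => i _; rewrite mulrn_wge0 ?mulr_ge0 ?exprn_ge0.
Qed.

(** The remainder consists of the binomial terms of order i >= 2 in h, where |h|^i <= (|h|/s)^2 s^i;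
    what is left is part of the expansion of (|w| + s)^p. *)
Lemma expD_linear_approx (w h s : K) (p : nat) : 0 < s -> `|h| <= s ->
  `|(w + h) ^+ p - w ^+ p - p%:R * w ^+ p.-1 * h|
    <= (`|h| / s) ^+ 2 * (`|w| + s) ^+ p.
Proof.
move=> s0 hs; have s0' := ltW s0.
have q0 : 0 <= (`|h| / s) ^+ 2 by rewrite exprn_ge0 // divr_ge0.
case: p => [|[|p]].
- by rewrite !expr0 !mul0r subrr subr0 normr0 mulr1.
- rewrite !expr1 expr0 mul1r mul1r.
  have -> : w + h - w - h = 0 by ring.
  by rewrite normr0 mulr_ge0 ?addr_ge0.
rewrite !exprDn !(@big_ord_recl _ _ _ p.+2) !(@big_ord_recl _ _ _ p.+1) /=.
rewrite !subn0 !expr0 !mulr1 !bin0 !mulr1n.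
rewrite /bump /= !add1n bin1 !expr1 subn1 /=.
set S := \sum_(i < _) _; set T := \sum_(i < _) _.
have -> : w ^+ p.+2 + (w ^+ p.+1 * h *+ p.+2 + S) - w ^+ p.+2
          - p.+2%:R * w ^+ p.+1 * h = S.
  by rewrite -mulrA mulr_natl; ring.
have ST : `|S| <= (`|h| / s) ^+ 2 * T.
  rewrite mulr_sumr; apply: le_trans (ler_norm_sum _ _ _) _.
  apply: ler_sum => i _; rewrite /bump /= !add1n normrMn normrM !normrX.
  rewrite mulrnAr lerMn2r; apply/orP; right.
  rewrite [leRHS]mulrCA ler_wpM2l ?exprn_ge0 //.
  have -> : (`|h| / s) ^+ 2 * s ^+ i.+2 = s ^+ i * `|h| ^+ 2.
    by rewrite -[i.+2]addn2 exprD expr_div_n; field; rewrite gt_eqF.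
  by rewrite -[i.+2]addn2 exprD ler_wpM2r ?exprn_ge0 // lerXn2r ?nnegrE.
apply: le_trans ST _; rewrite ler_wpM2l // addrA lerDr.
by apply: addr_ge0; [apply: exprn_ge0|apply/mulrn_wge0/mulr_ge0; rewrite ?exprn_ge0].
Qed.

(** The error is t^m times the value of [drop_poly m P], which on the unit disc is at most the sum
    of the absolute values of its coefficients. *)
Lemma horner_approx (P : {poly K}) (m : nat) :
  exists2 C, 0 <= C & forall t, `|t| <= 1 ->
    `|P.[t] - \sum_(j < m) P`_j * t ^+ j| <= C * `|t| ^+ m.
Proof.
exists (\sum_(j < size (drop_poly m P)) `|(drop_poly m P)`_j|).
  exact: sumr_ge0.
move=> t t1; rewrite -{1}(poly_take_drop m P) hornerD hornerM hornerXn.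
rewrite /take_poly horner_poly addrC addKr normrM normrX ler_wpM2r ?exprn_ge0 //.
rewrite horner_coef; apply: le_trans (ler_norm_sum _ _ _) _.
apply: ler_sum => j _; rewrite normrM normrX ler_piMr // exprn_ile1 //.
Qed.

End Estimates.

(** * Partial sums of multiple series over boxes of exponents *)

Section BoxSums.
Variables (K : numFieldType) (d : nat).
Implicit Types F G : ('I_d -> nat) -> K.

(** Boxes of different sizes are different types; this puts both sums over one index type so that
    they can be subtracted. *)
Lemma boxsum_widen (M N : nat) F : (M <= N)%N ->
  boxsum M F = \sum_(al : {ffun 'I_d -> 'I_N} | [forall i, (al i < M)%N])
                  F (fun i => nat_of_ord (al i)).
Proof.
move=> leMN; pose h (al : {ffun 'I_d -> 'I_M}) : {ffun 'I_d -> 'I_N} :=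
  [ffun i => widen_ord leMN (al i)].
have h_inj : injective h.
  move=> al be /ffunP e; apply/ffunP => i; have := e i; rewrite !ffunE.
  by move=> /(congr1 val) /= ?; apply: val_inj.
transitivity (\sum_(al in [set h be | be in [set: {ffun 'I_d -> 'I_M}]]%SET)
                 F (fun i => nat_of_ord (al i))).
  rewrite big_imset /=; last by move=> ? ? _ _; exact: h_inj.
  rewrite /boxsum; apply: eq_big => [al|al _]; first by rewrite finset.in_setT.
  by congr F; apply/funext => i; rewrite ffunE.
apply: eq_bigl => al; apply/imsetP/forallP => [[be _ ->] i|hal].
  by rewrite ffunE /=.
exists [ffun i => Ordinal (hal i)]; rewrite ?finset.in_setT //.
by apply/ffunP => i; rewrite !ffunE; apply: val_inj.
Qed.

(** Subtracting the smaller box leaves exactly the exponents with some component at least [M], so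
    domination is only required there. *)
Lemma boxsumB_le (M N : nat) F G : (M <= N)%N ->
  (forall al, (exists i, (M <= al i)%N) -> `|F al| <= G al) ->
  `|boxsum N F - boxsum M F| <= boxsum N G - boxsum M G.
Proof.
move=> leMN hFG.
have boxsumBE (H : ('I_d -> nat) -> K) : boxsum N H - boxsum M H =
    \sum_(al : {ffun 'I_d -> 'I_N} | ~~ [forall i, (al i < M)%N])
      H (fun i => nat_of_ord (al i)).
  rewrite (boxsum_widen _ leMN) /boxsum.
  rewrite (bigID (fun al : {ffun 'I_d -> 'I_N} => [forall i, (al i < M)%N])) /=.
  by rewrite addrAC subrr add0r.
rewrite !boxsumBE.
apply: le_trans (ler_norm_sum _ _ _) _; apply: ler_sum => al.
rewrite negb_forall => /existsP[i hi]; apply: hFG.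
by exists i; rewrite leqNgt.
Qed.

Lemma boxsum_le (N : nat) F G : (forall al, F al <= G al) ->
  boxsum N F <= boxsum N G.
Proof. by move=> h; apply: ler_sum. Qed.

Lemma boxsum_norm_le (N : nat) F G : (forall al, `|F al| <= G al) ->
  `|boxsum N F| <= boxsum N G.
Proof.
by move=> h; apply: le_trans (ler_norm_sum _ _ _) _; apply: ler_sum.
Qed.

Lemma boxsumZ (N : nat) (x : K) F :
  boxsum N (fun al => x * F al) = x * boxsum N F.
Proof. by rewrite /boxsum mulr_sumr. Qed.

Lemma boxsumB (N : nat) F G :
  boxsum N (fun al => F al - G al) = boxsum N F - boxsum N G.
Proof. by rewrite /boxsum sumrB. Qed.

Lemma boxsum_single (N : nat) (k : 'I_d -> nat) F :
  (forall i, (k i < N)%N) -> (forall al, al <> k -> F al = 0) ->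
  boxsum N F = F k.
Proof.
move=> hk hF; rewrite /boxsum (bigD1 [ffun i => Ordinal (hk i)]) //= big1.
  by rewrite addr0; congr F; apply/funext => i; rewrite ffunE.
move=> al /eqP hal; apply: hF => e; apply: hal; apply/ffunP => i.
by rewrite ffunE; apply: val_inj; rewrite /= -e.
Qed.

End BoxSums.

Local Notation boxsums F := (fun N => boxsum N F).

(** * Term-by-term differentiation of a multiple power series *)

Section PowerSeries.
Variables (K : numFieldType) (d : nat).
Hypothesis K_complete : dominated_complete K.
Local Notation idx := ('I_d -> nat).

(** The partial derivative of order k of c_al w^al. Truncated subtraction is harmless: the falling
    factorial vanishes when [al i < k i]. *)
Definition dterm (c : idx -> K) (k : idx) (w : 'I_d -> K) (al : idx) : K :=
  c al * \prod_(i < d) ((al i ^_ k i)%:R * w i ^+ (al i - k i)).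

Lemma pterm_dterm c (z0 z : 'rV[K]_d) :
  pterm c z0 z = dterm c (fun=> 0%N) (fun i => z 0 i - z0 0 i).
Proof.
apply/funext => al; congr (_ * _); apply: eq_bigr => i _.
by rewrite ffactn0 mul1r subn0.
Qed.

Lemma dterm_center c k : dterm c k (fun=> 0) k = c k * (mfact k)%:R.
Proof.
rewrite /dterm /mfact natr_prod; congr (_ * _); apply: eq_bigr => i _.
by rewrite subnn expr0 mulr1 ffactnn.
Qed.

Lemma dterm_center0 c k al : al <> k -> dterm c k (fun=> 0) al = 0.
Proof.
move=> ne; have [i hi] : exists i, al i != k i.
  apply: contra_notP ne => h; apply/funext => i.
  by apply/eqP/negPn/negP => hi; apply: h; exists i.
rewrite /dterm (bigD1 i) //= expr0n subn_eq0.
have [lt|gt|e] := ltngtP (al i) (k i); last by rewrite e eqxx in hi.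
  by rewrite ffact_small // !mul0r mulr0.
by rewrite mulr0 mul0r mulr0.
Qed.

Variables (c : idx -> K) (s B : K).
Hypothesis s_gt0 : 0 < s.
Let s_ge0 : 0 <= s := ltW s_gt0.

(* The weights are evaluated at radius 3s; two margins of width s are spent,
   one on the derivatives and one on the difference quotients. *)
Definition majorant (al : idx) : K := `|c al| * \prod_(i < d) (3 * s) ^+ al i.

Hypothesis majorant_bounded : forall N, boxsum N majorant <= B.

(** The factor k!/s^k of a Cauchy estimate, paid for shrinking the radius from 3s to 2s. *)
Definition dbound (k : idx) : K := \prod_(i < d) ((k i)`!%:R / s ^+ k i).

Lemma dbound_ge0 k : 0 <= dbound k.
Proof. by apply: prodr_ge0 => i _; rewrite divr_ge0 ?exprn_ge0. Qed.

Lemma dterm_majorant k al :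
  dterm (fun al => `|c al|) k (fun=> 2 * s) al <= dbound k * majorant al.
Proof.
rewrite /dterm /majorant mulrCA ler_wpM2l // /dbound -big_split /=.
apply: ler_prod => i _; rewrite mulr_ge0 ?exprn_ge0 ?mulr_ge0 //=.
have -> : 3 * s = 2 * s + s by ring.
by apply: ffact_exp_le; rewrite ?mulr_ge0.
Qed.

Lemma norm_dterm_le k w al : (forall i, `|w i| <= 2 * s) ->
  `|dterm c k w al| <= dbound k * majorant al.
Proof.
move=> hw; apply: le_trans (dterm_majorant k al).
rewrite /dterm normrM ler_wpM2l // normr_prod ler_prod // => i _.
rewrite normr_ge0 normrM normr_nat normrX ler_wpM2l //.
by rewrite lerXn2r ?nnegrE ?mulr_ge0.
Qed.

(** [lim] is total; [psum_cvg] shows that it is a genuine limit when all |w_i| <= 2s. *)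
Definition psum (k : idx) (w : 'I_d -> K) : K :=
  lim (boxsums (dterm c k w) @ \oo).

Lemma psum_cvg k w : (forall i, `|w i| <= 2 * s) ->
  boxsums (dterm c k w) @ \oo --> psum k w.
Proof.
move=> hw; apply/cvg_ex.
apply: (@K_complete _ (boxsums (fun al => dbound k * majorant al))).
  by move=> M N hMN; apply: boxsumB_le => // al _; exact: norm_dterm_le.
exists (dbound k * B) => N; rewrite boxsumZ ler_wpM2l //; exact: dbound_ge0.
Qed.

Definition shift1 (w : 'I_d -> K) (i : 'I_d) (h : K) : 'I_d -> K :=
  fun j => if j == i then w j + h else w j.

Definition incr (k : idx) (i : 'I_d) : idx := fun j => (k j + (j == i))%N.

(** Only the factor of index [i] moves, and [expD_linear_approx] controls it. Since |w_i| + s <= 2s,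
    the outcome is bounded by the term at radius 2s, to which [dterm_majorant] applies. *)
Lemma dterm_shift_approx k w i h al :
  (forall j, `|w j| <= s) -> `|h| <= s ->
  `|dterm c k (shift1 w i h) al - dterm c k w al - h * dterm c (incr k i) w al|
    <= (`|h| / s) ^+ 2 * (dbound k * majorant al).
Proof.
move=> hw hh; set q := _ ^+ 2.
have q0 : 0 <= q by rewrite exprn_ge0 // divr_ge0.
apply: le_trans (ler_wpM2l q0 (dterm_majorant k al)).
have D1 (F : 'I_d -> K) : \prod_(j < d) F j = F i * \prod_(j < d | j != i) F j.
  by rewrite (bigD1 i).
rewrite /dterm !D1 /shift1 /incr !eqxx addn1 ffactnSr subnS.
set p := (al i - k i)%N.
set P := \prod_(j | j != i) _; set P1 := \prod_(j | j != i) _.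
set P2 := \prod_(j | j != i) _; set P3 := \prod_(j | j != i) _.
have -> : P = P1 by apply: eq_bigr => j /negPf ->.
have -> : P2 = P1 by apply: eq_bigr => j /negPf ->; rewrite addn0.
have P13 : `|P1| <= P3.
  rewrite normr_prod ler_prod // => j _; rewrite normr_ge0 normrM normr_nat.
  rewrite normrX ler_wpM2l // lerXn2r ?nnegrE ?mulr_ge0 //.
  by rewrite (le_trans (hw j)) // mulr_natl mulr2n lerDl.
rewrite natrM.
have -> : c al * ((al i ^_ k i)%:R * (w i + h) ^+ p * P1)
    - c al * ((al i ^_ k i)%:R * w i ^+ p * P1)
    - h * (c al * ((al i ^_ k i)%:R * p%:R * w i ^+ p.-1 * P1))
  = c al * ((al i ^_ k i)%:R
      * ((w i + h) ^+ p - w i ^+ p - p%:R * w i ^+ p.-1 * h) * P1) by ring.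
rewrite normrM [leRHS]mulrCA ler_wpM2l // mulrA normrM.
apply: ler_pM => //; rewrite normrM normr_nat mulrCA ler_wpM2l //.
apply: le_trans (expD_linear_approx _ _ s_gt0 hh) _; rewrite ler_wpM2l //.
rewrite lerXn2r ?nnegrE ?addr_ge0 ?mulr_ge0 //.
by rewrite mulr_natl mulr2n lerD.
Qed.

Lemma psum_shift_approx k w i h : (forall j, `|w j| <= s) -> `|h| <= s ->
  `|psum k (shift1 w i h) - psum k w - h * psum (incr k i) w|
    <= (`|h| / s) ^+ 2 * (dbound k * B).
Proof.
move=> hw hh.
have le12 x : x <= s -> x <= 2 * s.
  by move=> /le_trans; apply; rewrite mulr_natl mulr2n lerDl.
have cw l : boxsums (dterm c l w) @ \oo --> psum l w.
  by apply: psum_cvg => j; exact: le12.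
have cwh : boxsums (dterm c k (shift1 w i h)) @ \oo --> psum k (shift1 w i h).
  apply: psum_cvg => j; rewrite /shift1; case: ifP => _; last exact: le12.
  by rewrite mulr_natl mulr2n (le_trans (ler_normD _ _)) // lerD.
have cvgd : (fun N => boxsum N (dterm c k (shift1 w i h)) - boxsum N (dterm c k w)
      - h * boxsum N (dterm c (incr k i) w)) @ \oo -->
    psum k (shift1 w i h) - psum k w - h * psum (incr k i) w.
  by apply: cvgB; [exact: cvgB | apply: cvgM => //; exact: cvg_cst].
apply: (@cvg_norm_le _ _ _ _ 0%N cvgd) => N _.
rewrite -boxsumZ -!boxsumB.
apply: le_trans (boxsum_norm_le _ (fun al => dterm_shift_approx k i al hw hh)) _.
rewrite !boxsumZ ler_wpM2l ?exprn_ge0 ?divr_ge0 // //.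
by rewrite ler_wpM2l // dbound_ge0.
Qed.

End PowerSeries.

(** * Derivatives of f at the centre and its expansion along the curve *)

Section Analytic.
Variables (K : numFieldType) (d : nat).
Hypothesis K_complete : dominated_complete K.
Variables (c : ('I_d -> nat) -> K) (s B : K).
Hypothesis s_gt0 : 0 < s.
Let s_ge0 : 0 <= s := ltW s_gt0.
Hypothesis majorant_bounded : forall N, boxsum N (majorant c s) <= B.
Variables (f : 'rV[K]_d -> K^o) (z0 : 'rV[K]_d).

Definition near_center (z : 'rV[K]_d) := forall i, `|z 0 i - z0 0 i| < s.

Hypothesis f_sum : forall z, near_center z ->
  boxsums (pterm c z0 z) @ \oo --> (f z : K).

Definition psum_at (k : 'I_d -> nat) (z : 'rV[K]_d) : K :=
  psum c k (fun i => z 0 i - z0 0 i).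

Lemma majorant_ge0 al : 0 <= majorant c s al.
Proof.
by rewrite mulr_ge0 // prodr_ge0 // => i _; rewrite exprn_ge0 // mulr_ge0.
Qed.

Lemma boxsum_majorant_ge0 N : 0 <= boxsum N (majorant c s).
Proof. by apply: sumr_ge0 => al _; exact: majorant_ge0. Qed.

Lemma bound_ge0 : 0 <= B.
Proof. exact: le_trans (boxsum_majorant_ge0 0) (majorant_bounded 0). Qed.

Lemma f_psum z : near_center z -> f z = psum_at (fun=> 0%N) z.
Proof.
move=> hz; apply/esym/cvg_lim; first exact: norm_hausdorff.
by rewrite -pterm_dterm; exact: f_sum.
Qed.

(** Dividing the quadratic error of [psum_shift_approx] by |h| leaves an error linear in |h|. The
    hypothesis concerns the polydisc only, which is open, so the lemma can be iterated. *)
Lemma pderiv_psum (g : 'rV[K]_d -> K^o) k i :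
  (forall z, near_center z -> g z = psum_at k z) ->
  forall z, near_center z -> pderiv i g z = psum_at (incr k i) z.
Proof.
move=> hg z hz; rewrite /pderiv /derive; apply: cvg_lim.
  exact: norm_hausdorff.
(* This margin keeps z + h e_i inside the polydisc. *)
have d0 : 0 < s - `|z 0 i - z0 0 i| by rewrite subr_gt0.
have C0 : 0 <= dbound s k * B / s ^+ 2.
  by rewrite divr_ge0 ?exprn_ge0 // mulr_ge0 ?dbound_ge0 // bound_ge0.
apply: (cvg_dist_linear C0 d0) => h h0 hd.
have coordE j : (h *: unitv K i + z) 0 j - z0 0 j =
    shift1 (fun l => z 0 l - z0 0 l) i h j.
  rewrite /shift1 /unitv !mxE eqxx /=; case: eqP => _.
    by rewrite mulr1; ring.
  by rewrite mulr0 add0r.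
have hz' : near_center (h *: unitv K i + z).
  move=> j; rewrite coordE /shift1; case: eqP => [->|_]; last exact: hz.
  by rewrite (le_lt_trans (ler_normD _ _)) // addrC -ltrBrDr.
rewrite /= !hg // /psum_at (_ : (fun l => _) = shift1 (fun l => z 0 l - z0 0 l) i h);
  last by apply/funext.
have hs : `|h| <= s by rewrite ltW // (lt_le_trans hd) // gerBl.
have hw j : `|z 0 j - z0 0 j| <= s by rewrite ltW.
have := psum_shift_approx K_complete s_gt0 majorant_bounded k i hw hs.
set x := psum c k _; set y := psum c k _; set u := psum c _ _ => hxy.
have -> : h^-1 *: (x - y) - u = h^-1 * (x - y - h * u).
  by rewrite mulrBr mulrA mulVf // mul1r.
rewrite normrM normfV ler_pdivrMl ?normr_gt0 //.
apply: le_trans hxy _; rewrite expr_div_n le_eqVlt; apply/orP; left; apply/eqP.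
by field; rewrite gt_eqF.
Qed.

Lemma iter_pderiv_psum n (g : 'rV[K]_d -> K^o) k i :
  (forall z, near_center z -> g z = psum_at k z) ->
  forall z, near_center z ->
    iter n (pderiv i) g z = psum_at (fun j => k j + (j == i) * n)%N z.
Proof.
move=> hg; elim: n => [|n IH] z hz /=.
  by rewrite hg //; congr psum_at; apply/funext => j; rewrite muln0 addn0.
rewrite (pderiv_psum _ IH) //; congr psum_at; apply/funext => j.
by rewrite /incr mulnS; lia.
Qed.

(** At the centre only the exponent k survives, so the box sums are constant once the box contains
    k. *)
Lemma psum_center k : psum c k (fun=> 0) = c k * (mfact k)%:R.
Proof.
apply: cvg_lim; first exact: norm_hausdorff.
apply: cvg_near_cst; exists (\sum_(i < d) (k i).+1)%N => // N /= hN.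
rewrite -dterm_center; apply: boxsum_single => [i|al].
  by apply: leq_trans hN; rewrite (bigD1 i) //= leq_addr.
exact: dterm_center0.
Qed.

Lemma Dmnm_center m : Dmnm m f z0 = c (mexp m) * (mfact (mexp m))%:R.
Proof.
(* Generalised to duplicate-free lists: after treating the variables in [t], the order of
   differentiation is m on [t] and 0 elsewhere. *)
have hfold (t : seq 'I_d) : uniq t -> forall z, near_center z ->
    foldr (fun i h => iter (mexp m i) (pderiv i) h) f t z =
    psum_at (fun j => if j \in t then mexp m j else 0%N) z.
  elim: t => [_|i t IH /= /andP[it /IH {}IH]] z hz; first exact: f_psum.
  rewrite (iter_pderiv_psum _ _ IH) //; congr psum_at; apply/funext => j.
  rewrite inE; case: eqP => [->|_]; first by rewrite (negPf it) mul1n.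
  by rewrite mul0n addn0.
rewrite /Dmnm hfold ?enum_uniq //; last by move=> i; rewrite subrr normr0.
rewrite -psum_center; congr psum; apply/funext => j; first by rewrite mem_enum.
exact: subrr.
Qed.

Variables (n : nat) (a : nat -> nat -> K).

(** The box of exponents with all components at most m gives a polynomial P in t, truncated by
    [horner_approx]. Outside the box some component is at least m + 1, and as gamma(t) = O(t) the
    tail is O(t^(m+1)). *)
Lemma curve_expansion m : exists C delta : K, [/\ 0 <= C, 0 < delta &
  forall t, `|t| < delta ->
    `|f (z0 + \row_(i < d) (curve n a i).[t]) -
      \sum_(j < m.+1) boxsum m.+1 (fun al => c al * (curve_mon n a al)`_j) * t ^+ j|
    <= C * `|t| ^+ m.+1].
Proof.
(* Each [curve i] has no constant term, so [horner_approx] at order 1 gives a linear bound. *)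
have /fin_all_exists2[A_ A_0 hA_] (i : 'I_d) : exists2 C, 0 <= C &
    forall t, `|t| <= 1 -> `|(curve n a i).[t]| <= C * `|t|.
  have [C C0 hC] := horner_approx (curve n a i) 1; exists C => // t /hC.
  by rewrite big_ord1 coef_curve /= if_same mul0r subr0 expr1.
pose A := \sum_i A_ i.
have A0 : 0 <= A by apply: sumr_ge0.
have hA (i : 'I_d) t : `|t| <= 1 -> `|(curve n a i).[t]| <= A * `|t|.
  move=> t1; apply: le_trans (hA_ i t t1) _; rewrite ler_wpM2r //.
  by rewrite /A (bigD1 i) //= lerDl sumr_ge0.
pose P := \sum_(al : {ffun 'I_d -> 'I_m.+1})
  c (fun i => nat_of_ord (al i)) *: curve_mon n a (fun i => nat_of_ord (al i)).
have [C1 C10 hC1] := horner_approx P m.+1.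
have sA : 0 < s + A by rewrite ltr_wpDr.
(* [C1] accounts for the truncation of P, the other summand for the tail. The radius s / (s + A)
   ensures both |t| <= 1 and A |t| < s. *)
exists (C1 + (A / s) ^+ m.+1 * B), (s / (s + A)); split.
- by rewrite addr_ge0 // mulr_ge0 ?bound_ge0 // exprn_ge0 // divr_ge0.
- exact: divr_gt0.
move=> t ht.
have t1 : `|t| <= 1.
  by rewrite ltW // (lt_le_trans ht) // ler_pdivrMr // mul1r lerDl.
have tA : A * `|t| < s.
  apply: le_lt_trans (_ : (s + A) * `|t| - s * `|t| < s).
    by rewrite mulrDl addrAC subrr add0r.
  rewrite ltrBlDr; apply: (@lt_le_trans _ _ s); rewrite ?lerDl ?mulr_ge0 //.
  by rewrite mulrC -ltr_pdivlMr.
set z := z0 + _.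
have zE i : z 0 i - z0 0 i = (curve n a i).[t].
  by rewrite !mxE addrAC subrr add0r.
have hz : near_center z by move=> i; rewrite zE (le_lt_trans (hA i t t1)).
set S := \sum_(j < m.+1) _.
have -> : f z - S = (f z - P.[t]) + (P.[t] - S) by ring.
apply: le_trans (ler_normD _ _) _; rewrite [leRHS]mulrDl addrC lerD //.
  have -> : S = \sum_(j < m.+1) P`_j * t ^+ j; last exact: hC1.
  apply: eq_bigr => j _; congr (_ * _); rewrite /P coef_sum.
  by apply: eq_bigr => al _; rewrite coefZ.
have -> : P.[t] = boxsum m.+1 (pterm c z0 z).
  rewrite /P horner_sum; apply: eq_bigr => al _; rewrite hornerZ /pterm.
  congr (_ * _); rewrite /curve_mon horner_prod; apply: eq_bigr => i _.
  by rewrite horner_exp zE.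
have cvgd : (fun N => boxsum N (pterm c z0 z) - boxsum m.+1 (pterm c z0 z)) @ \oo
    --> (f z : K) - boxsum m.+1 (pterm c z0 z).
  by apply: cvgB; [exact: f_sum | exact: cvg_cst].
apply: (@cvg_norm_le _ _ _ _ m.+1 cvgd) => N hN.
(* Each coordinate of gamma(t) is at most q times 3s, so a term is at most q^|al| times its
   majorant; as q <= 1 and |al| >= m + 1 in the tail, q^(m+1) factors out. *)
pose q := A * `|t| / s.
have q0 : 0 <= q by rewrite divr_ge0 // mulr_ge0.
have q1 : q <= 1 by rewrite ler_pdivrMr // mul1r ltW.
apply: le_trans (boxsumB_le (G := fun al => q ^+ m.+1 * majorant c s al) hN _) _.
  move=> al [i hi]; rewrite /pterm normrM /majorant mulrCA ler_wpM2l //.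
  rewrite normr_prod.
  apply: (@le_trans _ _ (\prod_(j < d) (q ^+ al j * (3 * s) ^+ al j))).
    apply: ler_prod => j _; rewrite normr_ge0 normrX -exprMn lerXn2r ?nnegrE //.
      by rewrite mulr_ge0 // mulr_ge0.
    rewrite zE; apply: le_trans (hA j t t1) _; rewrite /q.
    have -> : A * `|t| / s * (3 * s) = 3 * (A * `|t|).
      by field; rewrite gt_eqF.
    by rewrite ler_peMl ?mulr_ge0 // ler1n.
  rewrite big_split /= ler_wpM2r //.
    by apply: prodr_ge0 => j _; rewrite exprn_ge0 // mulr_ge0.
  by rewrite prodrXr ler_wiXn2l // (leq_trans hi) // (bigD1 i) //= leq_addr.
rewrite !boxsumZ -mulrBr mulrAC -exprMn mulrAC -/q ler_wpM2l ?exprn_ge0 //.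
by rewrite lerBlDr (le_trans (majorant_bounded N)) // lerDl boxsum_majorant_ge0.
Qed.

Hypothesis d_ge2 : (2 <= d)%N.

(** The factorials in [Dmnm_center] cancel those in [mcoeff_L]; the rest reindexes the support of
    L_m by a box, the extra exponents contributing 0. *)
Lemma polyD_L m : (m <= n)%N ->
  polyD (L d a m) f z0 = boxsum m.+1 (fun al => c al * (curve_mon n a al)`_m).
Proof.
move=> le_mn; rewrite /polyD.
under eq_bigr do rewrite Dmnm_center (mcoeff_L a d_ge2 _ le_mn) //
  [c _ * _]mulrC mulrA divfK ?mfact_neq0 // mulrC.
pose F (x : mpoly.multinom d) := c (mexp x) * (curve_mon n a (mexp x))`_m.
pose e (al : {ffun 'I_d -> 'I_m.+1}) : mpoly.multinom d :=
  mpoly.Multinom [tuple nat_of_ord (al i) | i < d].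
have mexp_e al : mexp (e al) = (fun i => nat_of_ord (al i)).
  by apply/funext => i; rewrite /mexp /e multinomE tnth_mktuple.
have e_inj : injective e.
  move=> al be eab; apply/ffunP => i; apply: val_inj.
  by have := congr1 (@mexp d ^~ i) eab; rewrite !mexp_e.
transitivity (\sum_(x <- [seq e al | al <- enum {: {ffun 'I_d -> 'I_m.+1}}]) F x).
  rewrite [LHS](bigID (fun x => F x == 0)) [RHS](bigID (fun x => F x == 0)) /=.
  rewrite [X in X + _]big1 ?[X in _ = X + _]big1 ?add0r; try by move=> x /eqP.
  rewrite -big_filter -[RHS]big_filter; apply: perm_big; apply: uniq_perm.
  - by rewrite filter_uniq // mpoly.msupp_uniq.
  - by rewrite filter_uniq // map_inj_uniq ?enum_uniq.
  move=> x; rewrite !mem_filter; apply: andb_id2l => Fx.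
  have Lx : (curve_mon n a (mexp x))`_m != 0.
    by apply: contraNneq Fx => x0; rewrite /F x0 mulr0.
  rewrite mpoly.mcoeff_msupp (mcoeff_L a d_ge2 _ le_mn) //.
  rewrite mulf_neq0 ?invr_eq0 ?mfact_neq0 //.
  (* A component above m would force |al| > m, where the coefficient of t^m vanishes. *)
  have lex (i : 'I_d) : (mexp x i < m.+1)%N.
    rewrite ltnS leqNgt; apply: contraNN Lx => lt_m; apply/eqP.
    by apply: coef_curve_mon_lt; rewrite (bigD1 i) //= ltn_addr.
  apply/esym/mapP; exists [ffun i => Ordinal (lex i)]; first by rewrite mem_enum.
  apply/mpoly.mnmP => i; rewrite -[LHS]/(mexp x i) -[RHS]/(mexp (e _) i).
  by rewrite mexp_e ffunE.
rewrite big_map big_enum; apply: eq_bigr => al _.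
by rewrite /F mexp_e.
Qed.

End Analytic.

(** With t = r h in [curve_expansion], the weights reduce the polynomial part to exactly h^m p_m,
    and the remainders add up to O(h^(m+1)); division by h^m leaves p_m + O(h). *)
Lemma interpolation_limit (K : numFieldType) :
  dominated_complete K -> theorem9_for K.
Proof.
move=> K_complete d n d_ge2 _ a z0 f [c [r [r0 hc]]] m le_mn.
(* Then 3s < r, so absolute convergence at z_0 + (3s, ..., 3s) bounds the sums of majorants. *)
pose s := r / 4.
have s0 : 0 < s by rewrite divr_gt0.
have s_le_r : s <= r by rewrite ler_pdivrMr // ler_peMr ?ler1n // ltW.
have [B hB] : exists B, forall N, boxsum N (majorant c s) <= B.
  have [i|[B hB] _] := hc (z0 + const_mx (3 * s)).
    rewrite !mxE addrAC subrr add0r gtr0_norm ?mulr_gt0 // /s mulrCA gtr_pMr //.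
    by rewrite ltr_pdivrMr // mul1r ltr_nat.
  exists B => N; apply: le_trans (hB N); apply: boxsum_le => al.
  rewrite /majorant /pterm normrM ler_wpM2l // normr_prod ler_prod // => i _.
  by rewrite !mxE addrAC subrr add0r normrX ger0_norm ?lexx
    ?exprn_ge0 ?mulr_ge0 ?ltW.
have f_sum z : near_center s z0 z -> boxsums (pterm c z0 z) @ \oo --> (f z : K).
  by move=> hz; have [i|_ //] := hc z; rewrite (lt_le_trans (hz i)).
rewrite (polyD_L K_complete s0 hB f_sum a d_ge2 le_mn).
have [C [delta [C0 d0 hC]]] := curve_expansion s0 hB f_sum n a m.
pose p j := boxsum m.+1 (fun al => c al * (curve_mon n a al)`_j).
pose D := \sum_(r < m.+1) `|Acoef K m r| * (C * r%:R ^+ m.+1).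
have D0 : 0 <= D by apply: sumr_ge0 => i _; rewrite !mulr_ge0 // exprn_ge0.
(* This radius guarantees |r h| < delta for every node r <= m at once. *)
have dm0 : 0 < delta / m.+1%:R by rewrite divr_gt0 // ltr0n.
apply: (cvg_dist_linear D0 dm0) => h h0 hd.
have zptE i : zpt a n z0 i h = z0 + \row_(j < d) (curve n a j).[i%:R * h].
  congr (_ + _); apply/matrixP => x j; rewrite !mxE /curve.
  case: eqP => _; first by rewrite hornerX.
  by rewrite horner_sum; apply: eq_bigr => l _; rewrite hornerZ hornerXn.
have main_term : \sum_(r < m.+1) Acoef K m r *
    \sum_(j < m.+1) p j * (r%:R * h) ^+ j = h ^+ m * p m.
  transitivity (\sum_(j < m.+1) p j * h ^+ j * (j == m :> nat)%:R).
    under eq_bigr do rewrite mulr_sumr.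
    rewrite exchange_big; apply: eq_bigr => j _.
    have le_jm : (j <= m)%N by rewrite -ltnS.
    rewrite -(sum_Acoef_exp 0 le_jm) mulr_sumr; apply: eq_bigr => i _.
    by rewrite add0r exprMn; ring.
  rewrite (bigD1 ord_max) //= eqxx mulr1 big1 ?addr0 1?mulrC // => j.
  by rewrite -val_eqE /= => /negPf ->; rewrite mulr0.
have -> : h ^- m * \sum_(r < m.+1) Acoef K m r * f (zpt a n z0 r h) - p m =
    h ^- m * \sum_(r < m.+1) Acoef K m r *
      (f (zpt a n z0 r h) - \sum_(j < m.+1) p j * (r%:R * h) ^+ j).
  under [in RHS]eq_bigr do rewrite mulrBr.
  by rewrite sumrB main_term mulrBr mulKf // expf_neq0.
rewrite normrM normfV normrX ler_pdivrMl ?exprn_gt0 ?normr_gt0 //.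
rewrite mulrCA -exprSr; apply: le_trans (ler_norm_sum _ _ _) _.
rewrite mulr_suml; apply: ler_sum => i _; rewrite normrM -!mulrA ler_wpM2l //.
rewrite zptE; apply: le_trans (hC _ _) _.
  rewrite normrM normr_nat; apply: (@le_lt_trans _ _ (m.+1%:R * `|h|)).
    by rewrite ler_wpM2r // ler_nat ltnW.
  by rewrite mulrC -ltr_pdivlMr // ltr0n.
by rewrite normrM normr_nat exprMn.
Qed.

(* F ranges over {R, C}: R is any realType (the real numbers), C = R[i]. *)
Theorem theorem9 (R : realType) : theorem9_for R /\ theorem9_for R[i].
Proof.
split; apply: interpolation_limit.
  exact: dominated_complete_real.
exact: dominated_complete_complex.
Qed.
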